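(* Let $d, m \ge 1$ be integers, let $S_{t-1} \in \mathbb{R}^{d \times m}$, $k_t \in \mathbb{R}^m$, $x_t \in \mathbb{R}^d$, and let $\beta_t \in \mathbb{R}^d$ have nonnegative entries $\beta_{t,i} \ge 0$. Then the minimization problem $$S_t = \operatorname*{arg\,min}_{S \in \mathbb{R}^{d \times m}} \left\{ \|S - S_{t-1}\|_{\mathrm{F}}^2 + \|S k_t - x_t\|_{\operatorname{diag}(\beta_t)}^2 \right\}$$ has as its solution the matrix $S_t$ whose rows are given, for every $i \in \{1,\dots,d\}$, by $$S_{t,i} = \left(I - \varepsilon_{t,i}\, k_t k_t^\top\right) S_{t-1,i} + \varepsilon_{t,i}\, k_t\, x_{t,i}, \qquad \text{where } \varepsilon_{t,i} = \frac{\beta_{t,i}}{1 + \beta_{t,i}\, k_t^\top k_t} \in [0, \infty).$$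
   Context: $\|\cdot\|_{\mathrm{F}}$ is the Frobenius norm. For $v \in \mathbb{R}^d$ and $\beta \in \mathbb{R}^d$ with nonnegative entries, $\|v\|_{\operatorname{diag}(\beta)}^2 = v^\top \operatorname{diag}(\beta)\, v = \sum_{i=1}^d \beta_i v_i^2$. For a matrix $S \in \mathbb{R}^{d\times m}$, $S_{i}$ (and likewise $S_{t,i}$, $S_{t-1,i}$ for $S_t$, $S_{t-1}$) denotes the $i$-th row, regarded as a column vector in $\mathbb{R}^m$; $\beta_{t,i}$ and $x_{t,i}$ are the $i$-th entries of $\beta_t$ and $x_t$. $I$ is the $m \times m$ identity matrix. The subscript $t$ is a fixed time index. The notation $S_t = \operatorname{arg\,min}$ means that $S_t$ is the unique minimizer. *)

(* Defs.v *)
From mathcomp Require Import all_boot all_order all_algebra.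
From mathcomp Require Import reals.

Set Implicit Arguments.
Unset Strict Implicit.
Unset Printing Implicit Defensive.

Import Order.TTheory GRing.Theory Num.Theory.

Local Open Scope ring_scope.

Definition frobenius_norm (R : realType) (m n : nat) (A : 'M[R]_(m, n)) : R :=
  Num.sqrt (\sum_(i < m) \sum_(j < n) A i j ^+ 2).

(* The square of the seminorm || v ||_{diag(beta)}; diag_mx expects a row. *)
Definition diag_norm_sq (R : realType) (d : nat) (beta v : 'cV[R]_d) : R :=
  (v^T *m diag_mx beta^T *m v) 0 0.

Definition row_vec (R : realType) (d m : nat) (S : 'M[R]_(d, m)) (i : 'I_d) :
  'cV[R]_m := (row i S)^T.

Definition is_minimizer (R : realType) (T : Type) (f : T -> R) (x : T) : Prop :=
  forall y, f x <= f y.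

(* x = argmin f, read as: x is the one and only minimizer of f. *)
Definition is_argmin (R : realType) (T : Type) (f : T -> R) (x : T) : Prop :=
  unique (is_minimizer f) x.

Definition objective (R : realType) (d m : nat) (S0 : 'M[R]_(d, m))
    (k : 'cV[R]_m) (x beta : 'cV[R]_d) (S : 'M[R]_(d, m)) : R :=
  frobenius_norm (S - S0) ^+ 2 + diag_norm_sq beta (S *m k - x).

Definition epsilon (R : realType) (d m : nat) (k : 'cV[R]_m) (beta : 'cV[R]_d)
    (i : 'I_d) : R :=
  beta i 0 / (1 + beta i 0 * (k^T *m k) 0 0).

(* Main.v *)
(* The objective is quadratic, so its expansion around a critical point S has
   no linear term: moving from S to S + D raises it by
   ||D||_F^2 + ||D k||_{diag(beta)}^2, which is positive unless D = 0.
   Hence a critical point is the unique minimizer, and the stated rows solve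
   the critical-point equation because epsilon_i (1 + beta_i k^T k) = beta_i. *)
Require Import Defs.
From mathcomp Require Import all_boot all_order all_algebra.
From mathcomp Require Import reals.
From mathcomp Require Import ring.

Set Implicit Arguments.
Unset Strict Implicit.
Unset Printing Implicit Defensive.

Import Order.TTheory GRing.Theory Num.Theory.

Local Open Scope ring_scope.

Lemma sqr_frobenius_norm (R : realType) (m n : nat) (A : 'M[R]_(m, n)) :
  frobenius_norm A ^+ 2 = \sum_i \sum_j A i j ^+ 2.
Proof.
by rewrite sqr_sqrtr //; do 2![apply: sumr_ge0 => ? _]; exact: sqr_ge0.
Qed.

(** The hypothesis is an upper bound because comparing two minimizers yields an inequality. *)
Lemma sqr_frobenius_norm_eq0 (R : realType) (m n : nat) (A : 'M[R]_(m, n)) :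
  frobenius_norm A ^+ 2 <= 0 -> A = 0.
Proof.
move=> A_le0; have row_ge0 i : 0 <= \sum_j A i j ^+ 2.
  by apply: sumr_ge0 => j _; exact: sqr_ge0.
have /eqP : \sum_i \sum_j A i j ^+ 2 = 0.
  by apply/le_anti; rewrite -sqr_frobenius_norm A_le0 sqr_ge0.
rewrite psumr_eq0 // => /allP rows0; apply/matrixP => i j; rewrite mxE.
have := rows0 i (mem_index_enum i).
rewrite psumr_eq0 => [|l _]; last exact: sqr_ge0.
by move=> /allP /(_ j (mem_index_enum j)); rewrite sqrf_eq0 => /eqP.
Qed.

Lemma diag_norm_sqE (R : realType) (d : nat) (beta v : 'cV[R]_d) :
  diag_norm_sq beta v = \sum_i beta i 0 * v i 0 ^+ 2.
Proof.
rewrite /diag_norm_sq -mulmxA mxE; apply: eq_bigr => i _.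
by rewrite mul_diag_mx !mxE expr2 mulrCA.
Qed.

Lemma diag_norm_sq_ge0 (R : realType) (d : nat) (beta v : 'cV[R]_d) :
  (forall i, 0 <= beta i 0) -> 0 <= diag_norm_sq beta v.
Proof.
move=> beta_ge0; rewrite diag_norm_sqE; apply: sumr_ge0 => i _.
by rewrite mulr_ge0 ?sqr_ge0.
Qed.

Section CriticalPoint.
Variables (R : realType) (d m : nat) (S0 : 'M[R]_(d, m)) (k : 'cV[R]_m).
Variables (x beta : 'cV[R]_d) (S : 'M[R]_(d, m)).
(** The left-hand side is half the partial derivative of the objective in the entry [S i j], so
    criticality is expressed without differentiation. *)
Hypothesis critS : forall i j,
  (S - S0) i j + beta i 0 * (S *m k - x) i 0 * k j 0 = 0.

Lemma objective_critical_add (D : 'M[R]_(d, m)) :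
  objective S0 k x beta (S + D) =
  objective S0 k x beta S + (frobenius_norm D ^+ 2 + diag_norm_sq beta (D *m k)).
Proof.
rewrite /objective !sqr_frobenius_norm !diag_norm_sqE -!big_split /=.
apply: eq_bigr => i _; set r := (S *m k - x) i 0.
have -> : ((S + D) *m k - x) i 0 = r + (D *m k) i 0.
  by rewrite /r mulmxDl !mxE; ring.
(* By [critS], the cross term of row [i] is a multiple of [(D *m k) i 0]. It cancels the cross term
   of [beta i 0 * (r + (D *m k) i 0) ^+ 2]. *)
have -> : \sum_j (S + D - S0) i j ^+ 2 =
    \sum_j (S - S0) i j ^+ 2 + \sum_j D i j ^+ 2
    - 2 * beta i 0 * r * (D *m k) i 0.
  rewrite [(D *m k) i 0]mxE mulr_sumr -sumrN -!big_split /=.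
  apply: eq_bigr => j _.
  have -> : (S + D - S0) i j = (S - S0) i j + D i j by rewrite !mxE; ring.
  by have /eqP := critS i j; rewrite addr_eq0 -/r => /eqP ->; ring.
by ring.
Qed.

Lemma critical_is_argmin :
  (forall i, 0 <= beta i 0) -> is_argmin (objective S0 k x beta) S.
Proof.
move=> beta_ge0; split=> [T | T minT]; first rewrite -(subrK S T) [_ + S]addrC.
  by rewrite objective_critical_add lerDl addr_ge0 ?sqr_ge0 ?diag_norm_sq_ge0.
(* Uniqueness: expanding around [S] with [D = T - S], minimality of [T] forces the increment to be
   at most 0. Its diagonal part is nonnegative, so the Frobenius part is at most 0 too. *)
have := minT S; rewrite -{1}(subrK S T) [_ + S]addrC objective_critical_add.
rewrite gerDl => le0; apply/esym/eqP; rewrite -subr_eq0; apply/eqP.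
apply: sqr_frobenius_norm_eq0; apply: le_trans le0.
by rewrite lerDl diag_norm_sq_ge0.
Qed.

End CriticalPoint.

Theorem theorem3p1 (R : realType) (d m : nat) (d_ge1 : (1 <= d)%N)
    (m_ge1 : (1 <= m)%N) (S0 : 'M[R]_(d, m)) (k : 'cV[R]_m)
    (x beta : 'cV[R]_d) (beta_ge0 : forall i : 'I_d, 0 <= beta i 0) :
  (forall i : 'I_d, epsilon k beta i \in `[0, +oo[) /\
  (exists S : 'M[R]_(d, m),
    is_argmin (objective S0 k x beta) S /\
    (forall i : 'I_d,
      row_vec S i =
        (1%:M - epsilon k beta i *: (k *m k^T)) *m row_vec S0 i
        + epsilon k beta i *: (x i 0 *: k))).
Proof.
have kk_ge0 : 0 <= (k^T *m k) 0 0.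
  by rewrite mxE; apply: sumr_ge0 => j _; rewrite mxE -expr2 sqr_ge0.
have den_gt0 i : 0 < 1 + beta i 0 * (k^T *m k) 0 0.
  by rewrite ltr_pwDl // mulr_ge0.
split=> [i|]; first by rewrite in_itv /= andbT divr_ge0 // ltW.
pose rowS i := (1%:M - epsilon k beta i *: (k *m k^T)) *m row_vec S0 i
  + epsilon k beta i *: (x i 0 *: k).
pose S := \matrix_i (rowS i)^T.
(* Since [k^T] times row [i] of [S0] is the scalar [(S0 *m k) i 0], the rank-one update only shifts
   that row along [k], in proportion to its residual. *)
have SE i j :
    S i j = S0 i j + epsilon k beta i * (x i 0 - (S0 *m k) i 0) * k j 0.
  have kS0 : k^T *m row_vec S0 i = ((S0 *m k) i 0)%:M.
    by rewrite [LHS]mx11_scalar -trmx_mul -row_mul !mxE.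
  rewrite mxE mxE /rowS mulmxBl mul1mx -scalemxAl -mulmxA kS0 mul_mx_scalar.
  move: (epsilon _ _ _) ((S0 *m k) i 0) => e p; rewrite !mxE; ring.
exists S; split=> [|i]; last by rewrite /row_vec rowK trmxK.
apply: critical_is_argmin => // i j.
have -> : (S *m k - x) i 0 = (S0 *m k) i 0 - x i 0
    + epsilon k beta i * (x i 0 - (S0 *m k) i 0) * (k^T *m k) 0 0.
  have SkE : (S *m k) i 0 = (S0 *m k) i 0
      + epsilon k beta i * (x i 0 - (S0 *m k) i 0) * (k^T *m k) 0 0.
    rewrite [(S *m k) i 0]mxE [(k^T *m k) 0 0]mxE mulr_sumr.
    rewrite {1}[(S0 *m k) i 0]mxE -big_split.
    by apply: eq_bigr => l _; rewrite SE [k^T _ _]mxE /=; ring.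
  by rewrite [LHS]mxE SkE [(- x) i 0]mxE; ring.
have -> : (S - S0) i j
    = epsilon k beta i * (x i 0 - (S0 *m k) i 0) * k j 0.
  by rewrite [LHS]mxE SE [(- S0) i j]mxE; ring.
(* Up to the common factor [(x i 0 - (S0 *m k) i 0) * k j 0], what remains is [epsilon - beta + beta
   * epsilon * (k^T k) = 0]; [den_gt0] makes the division legitimate. *)
rewrite /epsilon; field; exact: lt0r_neq0.
Qed.
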